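(* Let $0<r<1$ and let $T\in C_{1,r}$ act on a Hilbert space $\mathcal H$. Then there exists a unique orthogonal decomposition $\mathcal H=\mathcal H_1\oplus\mathcal H_2$ into closed subspaces reducing $T$ such that (1) $T|_{\mathcal H_1}\in\mathcal C_{1,r}$ and (2) $T|_{\mathcal H_2}$ is a c.n.u. $C_{1,r}$-contraction. Moreover, $\mathcal H_1$ is the maximal closed subspace reducing $T$ restricted to which $T\in\mathcal C_{1,r}$, and $$\mathcal H_1=\bigcap_{k\in\mathbb N}\ \bigcap_{n,m\in(\mathbb N\cup\{0\})^k}\left\{x\in\mathcal H: (1+r^2)\|p_{k,nm}(T)x\|^2-\|Tp_{k,nm}(T)x\|^2-r^2\|T^{-*}p_{k,nm}(T)x\|^2=0\right\},$$ where $p_{k,nm}(T)=T^{n_1}T^{*m_1}\cdots T^{n_k}T^{*m_k}$ for $n=(n_1,\dots,n_k)$, $m=(m_1,\dots,m_k)\in(\mathbb N\cup\{0\})^k$.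
   Context: $C_{1,r}=\{T: T\text{ invertible},\ \|T\|\le1,\ \|rT^{-1}\|\le1\}$. $\mathcal C_{1,r}$ is the class of operators $J$ on a Hilbert space $\mathcal L$ for which there exist orthogonal projections $P_0,P_1$ on $\mathcal L$ with $P_0+P_1=I_{\mathcal L}$ and $J^*J=P_0+r^2P_1$. An operator $T\in C_{1,r}$ on $\mathcal H$ is a c.n.u. $C_{1,r}$-contraction if $\mathcal H$ has no non-zero closed subspace that reduces $T$ to an operator in $\mathcal C_{1,r}$. $T^{-*}=(T^{-1})^*$. *)

(* Defs.v *)
(* Complex Hilbert space: a complete normed module H over C = R[i]
   (R : realType) together with an inner product inducing its norm. *)
From HB Require Import structures.
From mathcomp Require Import all_boot all_order all_algebra.
From mathcomp Require Import all_classical all_reals all_analysis.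
From mathcomp Require Import complex.
Set Implicit Arguments. Unset Strict Implicit. Unset Printing Implicit Defensive.
Import Order.TTheory GRing.Theory Num.Theory.
Import numFieldNormedType.Exports.
Local Open Scope ring_scope.
Local Open Scope classical_set_scope.
Local Open Scope complex_scope.

Section HilbertDefs.
Context {R : realType} {H : completeNormedModType R[i]}.
Local Notation C := R[i].

(* ip is an inner product (linear in the first variable, conjugate
   symmetric) whose associated norm is the norm of H. *)
Definition inner_product (ip : H -> H -> C) : Prop :=
  [/\ (forall (a : C) (x y z : H), ip (a *: x + y) z = a * ip x z + ip y z),
      (forall x y : H, ip y x = (ip x y)^*)
    & (forall x : H, ip x x = `|x| ^+ 2)].

(* linear map H -> H *)
Definition lin_op (A : H -> H) : Prop :=
  forall (a : C) (x y : H), A (a *: x + y) = a *: A x + A y.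

(* bounded (= continuous) linear operator *)
Definition bounded_op (A : H -> H) : Prop := lin_op A /\ continuous A.

(* B is the Hilbert-space adjoint of A *)
Definition is_adjoint (ip : H -> H -> C) (A B : H -> H) : Prop :=
  forall x y : H, ip (A x) y = ip x (B y).

(* orthogonal projection on H: bounded, idempotent, self-adjoint *)
Definition orth_proj (ip : H -> H -> C) (P : H -> H) : Prop :=
  [/\ bounded_op P, (forall x, P (P x) = P x) & is_adjoint ip P P].

(* closed linear subspace *)
Definition closed_subspace (M : set H) : Prop :=
  [/\ M 0, (forall (a : C) (x y : H), M x -> M y -> M (a *: x + y))
    & closed M].

(* M reduces T (T^* = Tadj): M is invariant under T and T^* *)
Definition reduces (T Tadj : H -> H) (M : set H) : Prop :=
  (forall x, M x -> M (T x)) /\ (forall x, M x -> M (Tadj x)).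

(* H = M1 (+) M2 orthogonal decomposition into closed subspaces *)
Definition orth_decomp (ip : H -> H -> C) (M1 M2 : set H) : Prop :=
  [/\ closed_subspace M1, closed_subspace M2,
      (forall x y, M1 x -> M2 y -> ip x y = 0)
    & (forall x, exists x1 x2, [/\ M1 x1, M2 x2 & x = x1 + x2])].

(* The restriction T|_M (M a closed subspace reducing T, so that
   (T|_M)^* = T^*|_M) belongs to the class C_{1,r}:
   T|_M invertible on M (T^{-1} maps M into M), ||T|_M|| <= 1 and
   ||r (T|_M)^{-1}|| <= 1. *)
Definition inC1r_on (r : R) (T Tinv : H -> H) (M : set H) : Prop :=
  (forall x, M x -> M (Tinv x)) /\
  (forall x, M x -> `|T x| <= `|x| /\ r%:C * `|Tinv x| <= `|x|).

(* The restriction T|_M belongs to the class \mathcal C_{1,r}: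
   there are orthogonal projections P0, P1 on the Hilbert space M with
   P0 + P1 = I_M and (T|_M)^*(T|_M) = P0 + r^2 P1.
   Orthogonal projections on M are encoded as orthogonal projections on H
   with range contained in M (i.e. extended by 0 on M^perp); since M
   reduces T, (T|_M)^* = T^*|_M. *)
Definition inCC1r_on (ip : H -> H -> C) (r : R) (T Tadj : H -> H)
  (M : set H) : Prop :=
  exists P0 P1 : H -> H,
    [/\ orth_proj ip P0, orth_proj ip P1,
        (forall x, M (P0 x)), (forall x, M (P1 x))
      & forall x, M x ->
          P0 x + P1 x = x /\ Tadj (T x) = P0 x + (r%:C ^+ 2) *: P1 x].

(* T|_M is a c.n.u. C_{1,r}-contraction: T|_M is in C_{1,r}, and M has
   no non-zero closed subspace reducing T|_M to an operator in
   \mathcal C_{1,r}. *)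
Definition cnu_on (ip : H -> H -> C) (r : R) (T Tadj Tinv : H -> H)
  (M : set H) : Prop :=
  inC1r_on r T Tinv M /\
  forall N : set H, closed_subspace N -> N `<=` M -> reduces T Tadj N ->
    inCC1r_on ip r T Tadj N -> N = [set 0].

(* p_{k,nm}(T) = T^{n_1} T^{*m_1} ... T^{n_k} T^{*m_k} *)
Definition pword (T Tadj : H -> H) (k : nat) (n m : 'I_k -> nat) : H -> H :=
  foldr (fun i f => iter (n i) T \o iter (m i) Tadj \o f) id (enum 'I_k).

(* The set on the right-hand side of the formula for H_1. *)
Definition H1_formula (r : R) (T Tadj Tinvadj : H -> H) : set H :=
  [set x | forall (k : nat), (0 < k)%N -> forall n m : 'I_k -> nat,
     let y := pword T Tadj n m x in
     (1 + r%:C ^+ 2) * `|y| ^+ 2 - `|T y| ^+ 2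
       - r%:C ^+ 2 * `|Tinvadj y| ^+ 2 = 0].

End HilbertDefs.

(* Main.v *)
(* Write A = T^* T, so r^2 <= A <= 1, and let defect(y) be the quantity in the
   formula for H_1, namely <(1 + r^2 - A - r^2 A^-1) y, y>. This operator is
   -(A - 1)(A - r^2) A^-1 and is nonnegative, so defect(y) = 0 if and only if
   (A - 1)(A - r^2) y = 0. The latter identity on a closed reducing subspace M
   says exactly that T|_M is in \mathcal C_{1,r}, with P_0 = (A - r^2) / (1 - r^2)
   and P_1 = (1 - A) / (1 - r^2) on M. Hence the set H_1 of the formula, an
   intersection of kernels of bounded operators that is stable under T and T^*,
   is the largest such M, and H_2 is its orthogonal complement. *)
Require Import Defs.
From HB Require Import structures.
From mathcomp Require Import all_boot all_order all_algebra.
From mathcomp Require Import all_classical all_reals all_analysis.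
From mathcomp Require Import complex ring.
Import Order.TTheory GRing.Theory Num.Theory.
Import numFieldNormedType.Exports.
Local Open Scope ring_scope.
Local Open Scope classical_set_scope.
Local Open Scope complex_scope.

(** * Inner-product calculus, adjoints and linear operators *)

Section InnerProduct.
Set Implicit Arguments. Unset Strict Implicit.
Context {R : realType} {H : completeNormedModType R[i]} {ip : H -> H -> R[i]}.
Hypothesis hip : inner_product ip.
Implicit Types (x y z : H) (a : R[i]).

Lemma ipDl x y z : ip (x + y) z = ip x z + ip y z.
Proof. by case: hip => h _ _; have := h 1 x y z; rewrite scale1r mul1r. Qed.

Lemma ip0l z : ip 0 z = 0.
Proof.
have /eqP := ipDl 0 0 z.
by rewrite addr0 -subr_eq0 opprD addNKr oppr_eq0 => /eqP.
Qed.

Lemma ipZl a x z : ip (a *: x) z = a * ip x z.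
Proof. by case: hip => h _ _; have := h a x 0 z; rewrite addr0 ip0l addr0. Qed.

Lemma ipC x y : ip y x = conjc (ip x y).
Proof. by case: hip. Qed.

Lemma ipxx x : ip x x = `|x| ^+ 2.
Proof. by case: hip. Qed.

Lemma ipDr x y z : ip z (x + y) = ip z x + ip z y.
Proof. by rewrite ipC ipDl rmorphD /= -!ipC. Qed.

Lemma ipZr a x z : ip z (a *: x) = conjc a * ip z x.
Proof. by rewrite ipC ipZl rmorphM /= -ipC. Qed.

Lemma ipNl x z : ip (- x) z = - ip x z.
Proof. by rewrite -scaleN1r ipZl mulN1r. Qed.

Lemma ipNr x z : ip z (- x) = - ip z x.
Proof. by rewrite ipC ipNl rmorphN /= -ipC. Qed.

Lemma ip0r z : ip z 0 = 0.
Proof. by rewrite ipC ip0l conjc0. Qed.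

Lemma ip_eq0 x : ip x x = 0 -> x = 0.
Proof. by rewrite ipxx => /eqP; rewrite sqrf_eq0 normr_eq0 => /eqP. Qed.

Lemma ip_inj x y : (forall z, ip x z = ip y z) -> x = y.
Proof.
move=> h; apply/eqP; rewrite -subr_eq0; apply/eqP/ip_eq0.
by rewrite {1}ipDl ipNl h subrr.
Qed.

Lemma ip_adjC (A B : H -> H) : is_adjoint ip A B -> is_adjoint ip B A.
Proof. by move=> h x y; rewrite ipC -h -ipC. Qed.

Lemma adj_lin (A B : H -> H) : is_adjoint ip A B -> lin_op B.
Proof.
move=> h a x y; apply: ip_inj => z.
by rewrite ipDl ipZl !(ip_adjC h) ipDl ipZl.
Qed.

(* Cauchy-Schwarz is the case [d = 0]; with [d] the squared distance to a subspace,
   it makes the difference to an almost nearest point almost orthogonal. *)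
Lemma ip_norm_le (d : R[i]) z m :
  (forall t : R[i], d <= `|z - t *: m| ^+ 2) ->
  `|ip z m| ^+ 2 <= (`|z| ^+ 2 - d) * `|m| ^+ 2.
Proof.
move=> h; have [->|m0] := eqVneq m 0.
  by rewrite ip0r !normr0 expr0n /= mulr0.
have m2 : 0 < `|m| ^+ 2 by rewrite exprn_gt0 // normr_gt0.
rewrite -ler_pdivrMr // -subr_ge0.
(* This coefficient minimizes [|z - t *: m|] over [t]. *)
have := h (ip z m / `|m| ^+ 2); rewrite -subr_ge0.
rewrite -!ipxx !(ipDl, ipNl, ipDr, ipNr, ipZl, ipZr) (ipC z m).
rewrite sqr_normc.
have -> : conjc (ip z m / ip m m) = conjc (ip z m) / ip m m.
  by rewrite rmorphM fmorphV /= -!ipC.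
have m1 : ip m m != 0 by rewrite ipxx lt0r_neq0.
by congr (0 <= _); field.
Qed.

Lemma cauchy_schwarz x y : `|ip x y| <= `|x| * `|y|.
Proof.
rewrite -(@ler_pXn2r _ 2) ?nnegrE ?mulr_ge0 // exprMn -[`|x| ^+ 2]subr0.
by apply: ip_norm_le => t; rewrite exprn_ge0.
Qed.

(** Cauchy-Schwarz on $\|Bx\|^2=\langle ABx,x\rangle$, then cancel $\|Bx\|$. The factor [c] covers
    both [T] ([c = 1]) and [Tinv] ([c = r]). *)
Lemma adj_contr (A B : H -> H) (c : R[i]) : 0 <= c -> is_adjoint ip A B ->
  (forall x, c * `|A x| <= `|x|) -> forall x, c * `|B x| <= `|x|.
Proof.
move=> c0 h hA x; have [->|b0] := eqVneq (B x) 0; first by rewrite normr0 mulr0.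
rewrite -(@ler_pM2r _ `|B x|) ?normr_gt0 // -mulrA -expr2 -ipxx.
rewrite -h; have := cauchy_schwarz (A (B x)) x; rewrite [X in `|X|]h.
rewrite ipxx ger0_norm ?exprn_ge0 // => hcs.
rewrite h ipxx; apply: le_trans (ler_wpM2l c0 hcs) _.
by rewrite mulrA mulrC ler_wpM2l.
Qed.

(** Equality case for contractions: expanding the square gives
    $\|ABy-y\|^2=\|ABy\|^2-2\|By\|^2+\|y\|^2=\|ABy\|^2-\|By\|^2\le0$. *)
Lemma contr_fix (A B : H -> H) : is_adjoint ip A B ->
  (forall x, `|A x| <= `|x|) -> forall y, `|B y| = `|y| -> A (B y) = y.
Proof.
move=> h hA y hy; apply/eqP; rewrite -subr_eq0 -normr_eq0 -sqrf_eq0.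
rewrite eq_le exprn_ge0 // andbT -ipxx.
have -> : ip (A (B y) - y) (A (B y) - y) = `|A (B y)| ^+ 2 - `|B y| ^+ 2.
  have e1 : ip (A (B y)) y = `|B y| ^+ 2 by rewrite h ipxx.
  have e2 : ip y (A (B y)) = `|B y| ^+ 2 by rewrite -(ip_adjC h) ipxx.
  rewrite !(ipDl, ipNl, ipDr, ipNr) e1 e2 !ipxx -hy.
  by ring.
by rewrite subr_le0 lerXn2r ?nnegrE.
Qed.

Lemma lin_opD (L : H -> H) : lin_op L -> {morph L : x y / x + y}.
Proof. by move=> h x y; have := h 1 x y; rewrite !scale1r. Qed.

Lemma lin_op0 (L : H -> H) : lin_op L -> L 0 = 0.
Proof. by move=> h; have := h (-1) 0 0; rewrite scaler0 addr0 scaleN1r addNr. Qed.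

Lemma lin_opZ (L : H -> H) : lin_op L -> forall a x, L (a *: x) = a *: L x.
Proof. by move=> h a x; have := h a x 0; rewrite (lin_op0 h) !addr0. Qed.

Lemma lin_opN (L : H -> H) : lin_op L -> {morph L : x / - x}.
Proof. by move=> h x; rewrite -scaleN1r (lin_opZ h) scaleN1r. Qed.

Lemma lin_opB (L : H -> H) : lin_op L -> {morph L : x y / x - y}.
Proof. by move=> h x y; rewrite (lin_opD h) (lin_opN h). Qed.

Lemma bounded_lin_continuous (L : H -> H) (K : R[i]) : 0 <= K -> lin_op L ->
  (forall x, `|L x| <= K * `|x|) -> continuous L.
Proof.
move=> K0 lL hK x; apply/cvgrPdist_lt => e e0.
have K1 : 0 < K + 1 by rewrite ltr_wpDl.
have e1 : 0 < e / (K + 1) by rewrite divr_gt0.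
move/cvgrPdist_lt: (@cvg_id _ (nbhs x)) => /(_ _ e1).
apply: filterS => y; rewrite -(lin_opB lL) ltr_pdivlMr // => h.
apply: le_lt_trans (hK _) (le_lt_trans _ h).
by rewrite mulrC ler_wpM2l // ler_wpDr.
Qed.

Lemma closed_ker (L : H -> H) : continuous L -> closed [set x | L x = 0].
Proof.
move/continuous_closedP => /(_ [set 0]); apply.
exact: (accessible_closed_set1 (hausdorff_accessible (@norm_hausdorff _ H))).
Qed.

(** * Orthogonal complements and nearest points of closed subspaces *)

Definition orth (M : set H) : set H := [set y | forall x, M x -> ip y x = 0].

Lemma orth_closed_subspace (M : set H) : closed_subspace (orth M).
Proof.
split=> [x _|a x y hx hy z hz|]; first by rewrite ip0l.
  by rewrite ipDl ipZl hx // hy // mulr0 addr0.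
(* Multiplying the scalar by [x] turns each condition into the kernel of a map [H -> H], to which
   [closed_ker] applies. *)
have -> : orth M = \bigcap_(x in M) [set y | ip y x *: x = 0].
  apply/seteqP; split=> y hy x /hy /=; first by move=> ->; rewrite scale0r.
  by move/eqP; rewrite scaler_eq0 => /orP[/eqP//|/eqP->]; rewrite ip0r.
apply: closed_bigI => x _; apply: closed_ker.
apply: (@bounded_lin_continuous _ (`|x| ^+ 2)); first by rewrite exprn_ge0.
  by move=> a y z; rewrite ipDl ipZl scalerDl scalerA.
move=> y; rewrite normrZ expr2 mulrAC ler_wpM2r // mulrC.
exact: cauchy_schwarz.
Qed.

(** Parallelogram identity at the midpoint of [m] and [m'], which lies in [M] and so has squared
    distance at least [d] to [x]. This makes minimizing families Cauchy. *)
Lemma minimizing_dist (M : set H) (x m m' : H) (d e : R[i]) : closed_subspace M ->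
  (forall m, M m -> d <= `|x - m| ^+ 2) -> M m -> M m' ->
  `|x - m| ^+ 2 < d + e -> `|x - m'| ^+ 2 < d + e ->
  `|m - m'| ^+ 2 < 4 * e.
Proof.
case=> M0 MD _ hd mM m'M h h'.
have Mu : M (2^-1 *: m + 2^-1 *: m').
  by apply: (MD) => //; rewrite -[2^-1 *: m']addr0; apply: MD.
have := hd _ Mu; rewrite -subr_ge0 => hu.
move: h h'; rewrite -subr_gt0 => h; rewrite -subr_gt0 => h'; rewrite -subr_gt0.
set u := _ *: m + _ in hu.
have par : `|m - m'| ^+ 2 = 2 * `|x - m| ^+ 2 + 2 * `|x - m'| ^+ 2 - 4 * `|x - u| ^+ 2.
  rewrite -!ipxx /u !(ipDl, ipNl, ipDr, ipNr, ipZl, ipZr) conjc_inv conjc_nat.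
  by field.
have -> : 4 * e - `|m - m'| ^+ 2 = 2 * (d + e - `|x - m| ^+ 2) +
   2 * (d + e - `|x - m'| ^+ 2) + 4 * (`|x - u| ^+ 2 - d).
  by rewrite par; ring.
by rewrite ltr_wpDr ?mulr_ge0 // addr_gt0 // mulr_gt0.
Qed.

(** Split [x - l = (x - m) - (l - m)]: [ip_norm_le] with excess at most [e ^+ 2] bounds the first
    part, Cauchy-Schwarz the second, each by [e * |y|]. *)
Lemma near_minimizer_orth (M : set H) (x l y : H) (d e : R[i]) : closed_subspace M ->
  (forall m, M m -> d <= `|x - m| ^+ 2) -> 0 < e -> M y ->
  (exists m, [/\ M m, `|x - m| ^+ 2 < d + e ^+ 2 & `|l - m| < e]) ->
  `|ip (x - l) y| <= 2 * e * `|y|.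
Proof.
move=> [M0 MD _] hd e0 My [m [Mm hm hl]].
have -> : x - l = (x - m) - (l - m) by rewrite opprB addrA subrK.
rewrite ipDl ipNl (le_trans (ler_normB _ _)) //.
rewrite [leRHS](_ : _ = e * `|y| + e * `|y|); last by ring.
apply: lerD; last first.
  by apply: le_trans (cauchy_schwarz _ _) _; rewrite ler_wpM2r // ltW.
rewrite -(@ler_pXn2r _ 2) ?nnegrE ?mulr_ge0 ?(ltW e0) //.
apply: le_trans (@ip_norm_le d _ _ _) _ => [t|].
  rewrite -addrA -opprD; apply: hd; rewrite addrC; exact: MD.
rewrite exprMn ler_wpM2r ?exprn_ge0 // lerBlDl.
exact: ltW.
Qed.

Lemma eq0_of_small (z : R[i]) (c : R[i]) : 0 <= c ->
  (forall e : R, 0 < e -> `|z| <= e%:C * c) -> z = 0.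
Proof.
move=> c0 h; apply/eqP; rewrite -normr_eq0; apply/negPn/negP => z0.
have zp : 0 < `|z| by rewrite lt0r z0 normr_ge0.
have cp : 0 < c + 1 by rewrite ltr_wpDl.
(* Testing [e = |z| / (c + 1)] would give $|z|\le|z|c/(c+1)<|z|$; this value is real because it is
   nonnegative in [R[i]]. *)
have qp : 0 < `|z| / (c + 1) by rewrite divr_gt0.
have qE : `|z| / (c + 1) = (complex.Re (`|z| / (c + 1)))%:C.
  by rewrite [LHS]complexE (ger0_Im (ltW qp)) mulr0 addr0.
have : `|z| <= `|z| / (c + 1) * c by rewrite qE; apply: h; rewrite -ltcR -qE.
by rewrite -mulrA ler_pMr // ler_pdivlMl // mulr1 gerDl ler10.
Qed.

Lemma orth_projection (M : set H) (x : H) : closed_subspace M ->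
  exists m, M m /\ orth M (x - m).
Proof.
move=> cM; have [M0 MD clM] := cM.
(* The order on [R[i]] is partial, so the infimum is taken over real parts; squared norms are real,
   so nothing is lost. *)
pose D := [set complex.Re (`|x - m| ^+ 2) | m in M].
have sqE m : `|x - m| ^+ 2 = (complex.Re (`|x - m| ^+ 2))%:C.
  by rewrite [LHS]complexE ger0_Im ?exprn_ge0 // mulr0 addr0.
have D0 : lbound D 0 by move=> _ [m _ <-]; rewrite -lecR -sqE exprn_ge0.
have hinf : has_inf D by split; [exists (complex.Re (`|x - 0| ^+ 2)), 0 | exists 0].
have hd m : M m -> (inf D)%:C <= `|x - m| ^+ 2.
  by move=> Mm; rewrite sqE lecR; apply: ge_inf; [exists 0 | exists m].
pose S (e : R) := [set m | M m /\ `|x - m| ^+ 2 < (inf D + e)%:C].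
have S_sub e e' : e <= e' -> S e `<=` S e'.
  by move=> le m [Mm hm]; split=> //; apply: lt_le_trans hm _; rewrite lecR lerD2l.
have S_ne e : 0 < e -> S e !=set0.
  move=> e0; have [_ [m Mm <-] h] := inf_adherent e0 hinf.
  by exists m; split=> //; rewrite sqE ltcR.
(* The sets of near-minimizers generate a filter whose limit is the nearest point; it replaces a
   minimizing sequence. *)
pose F := filter_from [set e : R | 0 < e] S.
have FF : ProperFilter F.
  apply: filter_from_proper => [|e /S_ne//]; apply: filter_from_filter.
    by exists 1 => /=.
  move=> e e' /= e0 e0'; exists (Num.min e e') => /=.
    by rewrite lt_min e0.
  by move=> m hm; split; apply: S_sub hm; rewrite ge_min lexx ?orbT.
have cF : cvg F.
  apply: cauchy_cvg; apply: cauchy_exP => eps eps0.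
  (* With this excess the bound of [minimizing_dist] becomes [eps ^+ 2]. *)
  have q0 : 0 < eps ^+ 2 / 4 by rewrite divr_gt0 ?exprn_gt0.
  have qE : eps ^+ 2 / 4 = (complex.Re (eps ^+ 2 / 4))%:C.
    by rewrite [LHS]complexE (ger0_Im (ltW q0)) mulr0 addr0.
  have q0' : 0 < complex.Re (eps ^+ 2 / 4) by rewrite -ltcR -qE.
  have [m [Mm hm]] := S_ne _ q0'.
  exists m; exists (complex.Re (eps ^+ 2 / 4)) => // m' [Mm' hm'].
  rewrite -ball_normE /= -(@ltr_pXn2r _ 2) ?nnegrE ?(ltW eps0) //.
  move: hm hm'; rewrite rmorphD /= -qE => hm hm'.
  have := minimizing_dist cM hd Mm Mm' hm hm'.
  by rewrite mulrC divfK ?pnatr_eq0.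
have Fl : (fun m => m) @ F --> lim F by [].
exists (lim F); split.
  apply: (closed_cvg _ clM _ _ Fl).
  by exists 1 => [|m []] //=.
move=> y My.
apply: (@eq0_of_small _ (2 * `|y|)) => [|e e0]; first by rewrite mulr_ge0.
rewrite mulrA [_ * 2]mulrC.
have e0' : 0 < e%:C :> R[i] by rewrite ltcR.
apply: (near_minimizer_orth cM hd e0' My).
have e2 : 0 < e ^+ 2 by rewrite exprn_gt0.
have h1 : F (S (e ^+ 2)) by exists (e ^+ 2).
have h2 : F [set m | `|lim F - m| < e%:C].
  by move/cvgrPdist_lt: Fl => /(_ _ e0').
have [m [[Mm hm] hm2]] := filter_ex (filterI h1 h2).
by exists m; split=> //; move: hm; rewrite rmorphD rmorphXn.
Qed.

End InnerProduct.

(** * Orthogonal projections as operators *)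

Section Projections.
Set Implicit Arguments. Unset Strict Implicit.
Context {R : realType} {H : completeNormedModType R[i]} {ip : H -> H -> R[i]}.
Hypothesis hip : inner_product ip.

(** Having an adjoint forces linearity, and $\|Px\|^2=\langle Px,x\rangle\le\|Px\|\|x\|$ gives
    continuity. *)
Lemma orth_projI (P : H -> H) :
  is_adjoint ip P P -> (forall x, P (P x) = P x) -> orth_proj ip P.
Proof.
move=> aP iP; split=> //; split; first exact: (adj_lin hip aP).
apply: (@bounded_lin_continuous R H _ 1) => //; first exact: (adj_lin hip aP).
move=> x; rewrite mul1r; have [->|Px0] := eqVneq (P x) 0; first by rewrite normr0.
have e : ip (P x) x = `|P x| ^+ 2 by rewrite -(ipxx hip) [RHS]aP iP aP.
rewrite -(@ler_pM2l _ `|P x|) ?normr_gt0 // -expr2.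
by have := cauchy_schwarz hip (P x) x; rewrite e ger0_norm ?exprn_ge0.
Qed.

Lemma orth_meet0 (M : set H) x : M x -> orth (ip := ip) M x -> x = 0.
Proof. by move=> Mx h; apply: (ip_eq0 hip); apply: h. Qed.

Lemma closed_subspaceB (M : set H) x y : closed_subspace M -> M x -> M y -> M (x - y).
Proof. by case=> _ h _ Mx My; rewrite addrC -scaleN1r; apply: h. Qed.

Lemma closed_subspaceZ (M : set H) a x : closed_subspace M -> M x -> M (a *: x).
Proof. by case=> M0 h _ Mx; rewrite -[_ *: _]addr0; apply: h. Qed.

(** Choose a nearest point for every [x]. Orthogonality of the residuals gives $\langle
    Px,Py\rangle=\langle x,Py\rangle$, hence self-adjointness by conjugate symmetry. *)
Lemma projection_onto (M : set H) : closed_subspace M ->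
  exists P : H -> H, [/\ orth_proj ip P, forall x, M (P x) & forall x, M x -> P x = x].
Proof.
move=> cM; have [P hP] := choice (fun x => orth_projection hip x cM).
have MP x : M (P x) by case: (hP x).
have oP x y : M y -> ip (x - P x) y = 0 by case: (hP x) => _; apply.
have PM x : M x -> P x = x.
  move=> Mx; apply/esym/eqP; rewrite -subr_eq0; apply/eqP.
  apply: (@orth_meet0 M); last by move=> y; apply: oP.
  exact: closed_subspaceB.
have ipP x y : ip (P x) (P y) = ip x (P y).
  by apply/esym/eqP; rewrite -subr_eq0 -(ipNl hip) -(ipDl hip) oP.
exists P; split=> //; apply: orth_projI => [x y|x]; last exact: PM.
by rewrite -[RHS]ipP [LHS](ipC hip y) -ipP -(ipC hip).
Qed.

End Projections.

(** * The defect, and the class $\mathcal C_{1,r}$ as a quadratic equation in $T^*T$ *)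

Section Defect.
Set Implicit Arguments. Unset Strict Implicit.
Context {R : realType} {H : completeNormedModType R[i]} {ip : H -> H -> R[i]}.
Context {r : R} {T Tadj Tinv Tinvadj : H -> H}.
Hypotheses (hip : inner_product ip) (r01 : 0 < r < 1).
Hypotheses (bT : bounded_op T) (aT : is_adjoint ip T Tadj).
Hypotheses (TK : cancel T Tinv) (TinvK : cancel Tinv T).
Hypothesis aTi : is_adjoint ip Tinv Tinvadj.
Hypothesis T_le : forall x, `|T x| <= `|x|.
Hypothesis Tinv_le : forall x, r%:C * `|Tinv x| <= `|x|.

Let lT : lin_op T := proj1 bT.
Let lTa : lin_op Tadj := adj_lin hip aT.

(* [(A - 1) (A - r^2) x] for [A = T^* T]. *)
Definition quad (x : H) : H :=
  Tadj (T (Tadj (T x))) - (1 + r%:C ^+ 2) *: Tadj (T x) + r%:C ^+ 2 *: x.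

Definition defect (y : H) : R[i] :=
  (1 + r%:C ^+ 2) * `|y| ^+ 2 - `|T y| ^+ 2 - r%:C ^+ 2 * `|Tinvadj y| ^+ 2.

Lemma Tinvadj_Tadj y : Tinvadj (Tadj y) = y.
Proof. by apply: (ip_inj hip) => z; rewrite (ip_adjC hip aTi) (ip_adjC hip aT) TinvK. Qed.

Lemma Tadj_Tinvadj y : Tadj (Tinvadj y) = y.
Proof. by apply: (ip_inj hip) => z; rewrite (ip_adjC hip aT) (ip_adjC hip aTi) TK. Qed.

Lemma Tadj_le x : `|Tadj x| <= `|x|.
Proof.
have := adj_contr hip (@ler01 R[i]) aT => /(_ _ x); rewrite mul1r; apply.
by move=> y; rewrite mul1r.
Qed.

Lemma r_gt0 : 0 < r%:C :> R[i]. Proof. by rewrite ltcR; case/andP: r01. Qed.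

Lemma gap_gt0 : 0 < 1 - r%:C ^+ 2 :> R[i].
Proof.
rewrite subr_gt0 expr_lt1 ?ltW ?r_gt0 //.
by rewrite -[1]/(1%:C) ltcR; case/andP: r01.
Qed.

(** The bound on [Tinv] passes to its adjoint [Tinvadj], which is then evaluated at [Tadj x]. *)
Lemma Tadj_ge x : r%:C * `|x| <= `|Tadj x|.
Proof.
by rewrite -{1}[x]Tinvadj_Tadj; apply: adj_contr (ltW r_gt0) aTi Tinv_le _.
Qed.

Lemma conj_r2 : conjc (r%:C ^+ 2) = r%:C ^+ 2 :> R[i].
Proof.
have -> : r%:C ^+ 2 = (r ^+ 2)%:C :> R[i] by rewrite rmorphXn.
exact: conjc_real.
Qed.

(* With [w = T^{-*} x] and [B = T T^*], the defect is [<(1 - B) (B - r^2) w, w>];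
   since [(1 - B) + (B - r^2) = 1 - r^2], it splits as a sum of two nonnegative
   terms. *)
Lemma defect_split x (w := Tinvadj x) (u := T x - r%:C ^+ 2 *: w) (v := w - T x) :
  (1 - r%:C ^+ 2) * defect x =
  (`|u| ^+ 2 - `|Tadj u| ^+ 2) + (`|Tadj v| ^+ 2 - r%:C ^+ 2 * `|v| ^+ 2).
Proof.
have xE : Tadj w = x by exact: Tadj_Tinvadj.
have Tu : Tadj u = Tadj (T x) - r%:C ^+ 2 *: x.
  by rewrite (lin_opB lTa) (lin_opZ lTa) xE.
have Tv : Tadj v = x - Tadj (T x) by rewrite (lin_opB lTa) xE.
have rc := conj_r2.
have e1 : ip (T x) w = ip x x by rewrite aT xE.
have e2 : ip w (T x) = ip x x by rewrite -(ip_adjC hip aT) xE.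
have e3 : ip (Tadj (T x)) x = ip (T x) (T x) by rewrite (ip_adjC hip aT).
have e4 : ip x (Tadj (T x)) = ip (T x) (T x) by rewrite -aT.
rewrite Tu Tv /defect -/w -!(ipxx hip) /u /v.
rewrite !(ipDl hip, ipNl hip, ipDr hip, ipNr hip, ipZl hip, ipZr hip) rc e1 e2 e3 e4.
by ring.
Qed.

(** Apply $T^{-*}$ to the quadratic equation. On solutions $T^{-*}$ thus becomes a polynomial in $T$
    and $T^*$. *)
Lemma quad0_Tinvadj x : quad x = 0 ->
  r%:C ^+ 2 *: Tinvadj x = (1 + r%:C ^+ 2) *: T x - T (Tadj (T x)).
Proof.
move=> q0; have lTia := adj_lin hip aTi; have := congr1 Tinvadj q0.
rewrite (lin_op0 lTia) (lin_opD lTia) (lin_opB lTia) !(lin_opZ lTia) !Tinvadj_Tadj.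
by move/eqP; rewrite addr_eq0 => /eqP/(congr1 -%R); rewrite opprK opprB.
Qed.

(** If the defect vanishes, so do both summands of [defect_split]; the first gives $\|T^*u\|=\|u\|$,
    hence $TT^*u=u$ by [contr_fix], and applying $T^*$ yields the quadratic equation. Conversely,
    pair [quad0_Tinvadj] with $T^{-*}x$. *)
Lemma defect_eq0 x : defect x = 0 <-> quad x = 0.
Proof.
split=> [d0|q0].
  have /= := defect_split x.
  set u := T x - _; set v := _ - T x.
  rewrite d0 mulr0 => /esym/eqP; rewrite paddr_eq0; last 2 first.
  - by rewrite subr_ge0 lerXn2r ?nnegrE ?Tadj_le.
  - rewrite subr_ge0 -exprMn lerXn2r ?nnegrE ?Tadj_ge //.
    by rewrite mulr_ge0 // ltW ?r_gt0.
  case/andP; rewrite subr_eq0 eqrXn2 ?normr_ge0 // => /eqP hu _.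
  have := contr_fix hip aT T_le (esym hu).
  have -> : Tadj u = Tadj (T x) - r%:C ^+ 2 *: x.
    by rewrite (lin_opB lTa) (lin_opZ lTa) Tadj_Tinvadj.
  rewrite (lin_opB lT) (lin_opZ lT) => /(congr1 Tadj).
  rewrite !(lin_opB lTa) !(lin_opZ lTa) Tadj_Tinvadj => /eqP.
  rewrite -subr_eq0 => /eqP <-; apply: (ip_inj hip) => z.
  rewrite !(ipDl hip, ipNl hip, ipZl hip); by ring.
have := congr1 (fun y => ip y (Tinvadj x)) (quad0_Tinvadj q0).
rewrite (ipZl hip) (ipDl hip) (ipNl hip) (ipZl hip) (ipxx hip) !aT !Tadj_Tinvadj.
rewrite (ip_adjC hip aT) !(ipxx hip) /defect => ->.
by ring.
Qed.

(** Since $P_0+P_1$ is the identity on $M$, which contains both ranges, $P_0P_1=P_1P_0=0$ on $M$. So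
    $T^*T$ is $1$ on the range of $P_0$ restricted to $M$ and $r^2$ on that of $P_1$, and the two
    factors of [quad] kill the two components. *)
Lemma inCC1r_quad (M : set H) : inCC1r_on ip r T Tadj M ->
  forall x, M x -> quad x = 0.
Proof.
move=> [P0 [P1 [[_ i0 _] [_ i1 _] M0 M1 h]]] x Mx.
have z01 : P0 (P1 x) = 0.
  have [+ _] := h _ (M1 x); rewrite i1 => /eqP.
  by rewrite -subr_eq0 addrK => /eqP.
have z10 : P1 (P0 x) = 0.
  have [+ _] := h _ (M0 x); rewrite i0 => /eqP.
  by rewrite -subr_eq0 addrAC subrr add0r => /eqP.
have A0 : Tadj (T (P0 x)) = P0 x.
  by have [_ ->] := h _ (M0 x); rewrite i0 z10 scaler0 addr0.
have A1 : Tadj (T (P1 x)) = r%:C ^+ 2 *: P1 x.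
  by have [_ ->] := h _ (M1 x); rewrite i1 z01 add0r.
have [xE AE] := h _ Mx; rewrite /quad AE.
rewrite (lin_opD lT) (lin_opZ lT) (lin_opD lTa) (lin_opZ lTa) A0 A1 -[in X in _ + X]xE.
by apply: (ip_inj hip) => z; rewrite !(ipDl hip, ipNl hip, ipZl hip, ip0l hip); ring.
Qed.

Lemma quad_inCC1r (M : set H) : closed_subspace M -> reduces T Tadj M ->
  (forall x, M x -> quad x = 0) -> inCC1r_on ip r T Tadj M.
Proof.
move=> cM [MT MTa] q0; have [P [[_ iP aP] MP PM]] := projection_onto hip cM.
have c0 : 1 - r%:C ^+ 2 != 0 :> R[i] by rewrite lt0r_neq0 ?gap_gt0.
pose A x := Tadj (T x).
have MA x : M x -> M (A x) by move/MT/MTa.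
have AD x y : A (x - y) = A x - A y by rewrite /A (lin_opB lT) (lin_opB lTa).
have AZ a x : A (a *: x) = a *: A x by rewrite /A (lin_opZ lT) (lin_opZ lTa).
have aA : is_adjoint ip A A by move=> x y; rewrite (ip_adjC hip aT) aT.
(* Projecting onto [M] first extends the spectral projection by zero off [M], as the encoding of
   projections on [M] requires. *)
pose P0 x := (1 - r%:C ^+ 2)^-1 *: (A (P x) - r%:C ^+ 2 *: P x).
have MP0 x : M (P0 x).
  apply: closed_subspaceZ => //; apply: closed_subspaceB => //; first exact/MA.
  exact: closed_subspaceZ.
(* The quadratic equation at [P x] puts the range of [P0] in the fixed space of [A]; with [P0E] this
   gives idempotence. *)
have AP0 x : A (P0 x) = P0 x.
  have /eqP := q0 _ (MP x); rewrite addr_eq0 subr_eq addrC => /eqP qx.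
  by rewrite AZ AD AZ {1}/A qx; congr (_ *: _); apply: (ip_inj hip) => z;
    rewrite !(ipDl hip, ipNl hip, ipZl hip); ring.
have P0E x : M x -> A x = x -> P0 x = x.
  move=> Mx Ax; rewrite /P0 PM // Ax -{1}[x]scale1r -scalerBl scalerA mulVf //.
  by rewrite scale1r.
have rc : conjc ((1 - r%:C ^+ 2)^-1) = (1 - r%:C ^+ 2)^-1.
  have -> : (1 - r%:C ^+ 2)^-1 = ((1 - r ^+ 2)^-1)%:C :> R[i].
    by rewrite fmorphV rmorphB rmorph1 rmorphXn.
  exact: conjc_real.
have rc2 := conj_r2.
have aP0 : is_adjoint ip P0 P0.
  (* [A P = P A P] because [M] is invariant under [A], and [P A P] is self-adjoint. *)
  move=> x y; have e : ip (A (P x)) y = ip x (A (P y)).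
    rewrite -[A (P x)]PM; last by apply: MA.
    by rewrite aP aA aP PM //; apply: MA.
  by rewrite /P0 (ipZl hip) (ipZr hip) (ipDl hip) (ipNl hip) (ipZl hip)
    (ipDr hip) (ipNr hip) (ipZr hip) rc rc2 e aP.
have oP0 : orth_proj ip P0 by apply: orth_projI => // x; rewrite P0E.
have P0P x : P0 (P x) = P0 x by rewrite /P0 iP.
exists P0, (fun x => P x - P0 x); split=> //.
- apply: orth_projI => // [x y|x].
    by rewrite (ipDl hip) (ipNl hip) (ipDr hip) (ipNr hip) aP aP0.
  rewrite (lin_opB (adj_lin hip aP)) (lin_opB (adj_lin hip aP0)) iP P0P.
  by rewrite (PM (P0 x)) // [P0 (P0 x)]P0E // subrr subr0.
- by move=> x; apply: closed_subspaceB.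
move=> x Mx; split; first by rewrite PM // addrC subrK.
rewrite PM // -[LHS]/(A x) /P0 PM //.
by apply: (ip_inj hip) => z; rewrite !(ipDl hip, ipNl hip, ipZl hip); field.
Qed.

End Defect.

(** * Words in $T$ and $T^*$ *)

Section Words.
Set Implicit Arguments. Unset Strict Implicit.
Context {R : realType} {H : completeNormedModType R[i]} {T Tadj : H -> H}.

(** One principle carries linearity, continuity and stability of reducing subspaces from the two
    letters to all words. *)
Lemma pword_ind (P : (H -> H) -> Prop) :
  P id -> (forall f, P f -> P (T \o f)) -> (forall f, P f -> P (Tadj \o f)) ->
  forall k (n m : 'I_k -> nat), P (pword T Tadj n m).
Proof.
move=> P1 PT PTa k n m; rewrite /pword; elim: (enum _) => //= i s IH.
elim: (n i) => [|a IHa] /=; last exact: PT.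
elim: (m i) => [|a IHa] /=; last exact: PTa.
exact: IH.
Qed.

(** Appending exponents adds the innermost factor, the one applied first; this is what makes the set
    of the formula stable under $T$ and $T^*$. *)
Lemma pword_rcons k (n m : 'I_k -> nat) (a b : nat) :
  exists n' m' : 'I_k.+1 -> nat,
    forall x, pword T Tadj n' m' x = pword T Tadj n m (iter a T (iter b Tadj x)).
Proof.
(* The default [c] is reached exactly at the new last index, where [insub] fails. *)
pose ext (c : nat) (l : 'I_k -> nat) (i : 'I_k.+1) :=
  if insub (i : nat) is Some j then l j else c.
have extw c l i : ext c l (widen_ord (leqnSn k) i) = l i.
  by rewrite /ext; case: insubP => [j _ /val_inj <-//|] /=; rewrite ltn_ord.
have extm c l : ext c l ord_max = c.
  by rewrite /ext; case: insubP => //= j; rewrite ltnn.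
exists (ext a n), (ext b m) => x.
rewrite /pword enum_ordSr foldr_rcons foldr_map !extm.
by elim: (enum _) => //= i s ->; rewrite !extw.
Qed.

End Words.

(** * The subspace $\mathcal H_1$, its complement, and uniqueness *)

Section Decomposition.
Set Implicit Arguments. Unset Strict Implicit.
Context {R : realType} {H : completeNormedModType R[i]} {ip : H -> H -> R[i]}.
Context {r : R} {T Tadj Tinv Tinvadj : H -> H}.
Hypotheses (hip : inner_product ip) (r01 : 0 < r < 1).
Hypotheses (bT : bounded_op T) (aT : is_adjoint ip T Tadj).
Hypotheses (TK : cancel T Tinv) (TinvK : cancel Tinv T).
Hypothesis aTi : is_adjoint ip Tinv Tinvadj.
Hypothesis T_le : forall x, `|T x| <= `|x|.
Hypothesis Tinv_le : forall x, r%:C * `|Tinv x| <= `|x|.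

Let lT : lin_op T := proj1 bT.
Let lTa : lin_op Tadj := adj_lin hip aT.
Local Notation quadT := (quad (R := R) (H := H) (r := r) (T := T) (Tadj := Tadj)).
Local Notation H1 := (@H1_formula R H r T Tadj Tinvadj).

Lemma H1_formulaE x : H1 x <->
  forall k, (0 < k)%N -> forall n m : 'I_k -> nat, quadT (pword T Tadj n m x) = 0.
Proof.
have E := defect_eq0 hip r01 bT aT TK TinvK aTi T_le Tinv_le.
by split=> h k k0 n m; apply/E; apply: h.
Qed.

Lemma Tadj_continuous : continuous Tadj.
Proof.
apply: (bounded_lin_continuous (@ler01 _) lTa) => x.
by rewrite mul1r; apply: (Tadj_le hip aT T_le).
Qed.

Lemma quad_lin : lin_op quadT.
Proof.
move=> a x y; rewrite /quad !(lT, lTa); apply: (ip_inj hip) => z.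
by rewrite !(ipDl hip, ipNl hip, ipZl hip); ring.
Qed.

Lemma quad_continuous : continuous quadT.
Proof.
apply: (bounded_lin_continuous (K := 1 + `|1 + r%:C ^+ 2| + `|r%:C ^+ 2|)) => [||x].
- by rewrite !addr_ge0.
- exact: quad_lin.
have A_le y : `|Tadj (T y)| <= `|y|.
  exact: le_trans (Tadj_le hip aT T_le _) (T_le _).
rewrite !mulrDl mul1r; apply: le_trans (ler_normD _ _) _; rewrite normrZ lerD2r.
apply: le_trans (ler_normB _ _) _; rewrite normrZ lerD ?ler_wpM2l //.
exact: le_trans (A_le _) (A_le _).
Qed.

Lemma H1_closed_subspace : closed_subspace H1.
Proof.
have wl k (n m : 'I_k -> nat) : lin_op (quadT \o pword T Tadj n m).
  move=> a x y /=; rewrite -quad_lin; congr quadT.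
  apply: (@pword_ind R H T Tadj (fun f => f (a *: x + y) = a *: f x + f y)) => //= f ->.
    exact: lT.
  exact: lTa.
have wc k (n m : 'I_k -> nat) : continuous (quadT \o pword T Tadj n m).
  suff cw : continuous (pword T Tadj n m).
    by move=> x; apply: continuous_comp; [exact: cw | exact: quad_continuous].
  apply: (@pword_ind R H T Tadj (fun f => continuous f)) => [x||]; first exact: cvg_id.
    by move=> f cf x; apply: continuous_comp; [exact: cf | case: bT => _; apply].
  by move=> f cf x; apply: continuous_comp; [exact: cf | exact: Tadj_continuous].
split.
- by apply/H1_formulaE => k _ n m; apply: (lin_op0 (wl k n m)).
- move=> a x y /H1_formulaE hx /H1_formulaE hy; apply/H1_formulaE => k k0 n m.
  have := wl k n m a x y => /= ->.
  by rewrite hx // hy // scaler0 addr0.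
have -> : H1 = \bigcap_(k in [set k | (0 < k)%N])
    \bigcap_(nm in [set: ('I_k -> nat) * ('I_k -> nat)])
      [set x | quadT (pword T Tadj nm.1 nm.2 x) = 0].
  apply/seteqP; split=> x.
    by move=> /H1_formulaE h k k0 [n m] _; apply: h.
  by move=> h; apply/H1_formulaE => k k0 n m; apply: (h k k0 (n, m)).
apply: closed_bigI => k k0; apply: closed_bigI => -[n m] _.
by apply: closed_ker; exact: wc.
Qed.

Lemma H1_reduces : reduces T Tadj H1.
Proof.
split=> x /H1_formulaE hx; apply/H1_formulaE => k k0 n m.
  have [n' [m' E]] := @pword_rcons R H T Tadj k n m 1%N 0%N.
  by have := hx k.+1 isT n' m'; rewrite E.
have [n' [m' E]] := @pword_rcons R H T Tadj k n m 0%N 1%N.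
by have := hx k.+1 isT n' m'; rewrite E.
Qed.

Lemma H1_quad x : H1 x -> quadT x = 0.
Proof.
(* The identity is the word of length one with zero exponents; length zero is excluded from the
   formula. *)
move/H1_formulaE => /(_ 1%N isT (fun=> 0%N) (fun=> 0%N)).
by rewrite /pword enum_ordSl (size0nil (size_enum_ord 0)).
Qed.

(** Every word maps [M] into itself, and the quadratic equation holds throughout [M]. *)
Lemma H1_maximal (M : set H) : reduces T Tadj M -> inCC1r_on ip r T Tadj M ->
  M `<=` H1.
Proof.
move=> [MT MTa] CM x Mx; apply/H1_formulaE => k _ n m.
apply: (inCC1r_quad hip bT aT CM).
by apply: (@pword_ind R H T Tadj (fun f => M (f x))) => //= f h; [apply: MT | apply: MTa].
Qed.

(** Serves for [H1] itself and, in the uniqueness proof, for its intersection with a competing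
    [K2]. *)
Lemma H1_sub_inCC1r (M : set H) : closed_subspace M -> reduces T Tadj M ->
  M `<=` H1 -> inCC1r_on ip r T Tadj M.
Proof.
move=> cM rM sM; apply: (quad_inCC1r hip r01 bT aT cM rM) => x /sM.
exact: H1_quad.
Qed.

Lemma orth_reduces (M : set H) : reduces T Tadj M ->
  reduces T Tadj (orth (ip := ip) M).
Proof.
move=> [MT MTa]; split=> x hx y My; first by rewrite aT hx //; apply: MTa.
by rewrite (ip_adjC hip aT) hx //; apply: MT.
Qed.

(** On [H1], $T^{-*}=r^{-2}((1+r^2)T-TT^*T)$, and [H1] reduces $T$. By duality the complement is
    then invariant under $T^{-1}$. *)
Lemma H1_Tinvadj x : H1 x -> H1 (Tinvadj x).
Proof.
move=> hx; have [HT HTa] := H1_reduces.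
have r2 : r%:C ^+ 2 != 0 :> R[i] by rewrite expf_neq0 // lt0r_neq0 // r_gt0.
have rw : r%:C ^+ 2 *: Tinvadj x = (1 + r%:C ^+ 2) *: T x - T (Tadj (T x)).
  exact: (quad0_Tinvadj hip aT TinvK aTi (H1_quad hx)).
rewrite -[Tinvadj x]scale1r -(mulVf r2) -scalerA rw.
have cH := H1_closed_subspace.
apply: (closed_subspaceZ _ cH); apply: (closed_subspaceB cH).
  by apply: (closed_subspaceZ _ cH); apply: HT.
by apply/HT/HTa/HT.
Qed.

(** A reducing subspace of the complement in $\mathcal C_{1,r}$ also lies in [H1] by maximality, so
    it is orthogonal to itself. *)
Lemma orth_H1_cnu : cnu_on ip r T Tadj Tinv (orth (ip := ip) H1).
Proof.
split.
  split=> x hx; last by split.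
  by move=> y hy; rewrite aTi hx //; apply: H1_Tinvadj.
move=> N cN sN rN CN; apply/seteqP; split=> x; last by move=> ->; case: cN.
move=> Nx; apply: (orth_meet0 hip (M := H1)); last exact: sN.
exact: H1_maximal CN _ Nx.
Qed.

Lemma orth_decomp_orth (M : set H) : closed_subspace M ->
  orth_decomp ip M (orth (ip := ip) M).
Proof.
move=> cM; split=> // [|x y Mx hy|x]; first exact: orth_closed_subspace.
  by rewrite (ipC hip) hy // conjc0.
have [m [Mm hm]] := orth_projection hip x cM.
by exists m, (x - m); split=> //; rewrite addrC subrK.
Qed.

Lemma orth_decomp_orthE (K1 K2 : set H) : orth_decomp ip K1 K2 -> K2 = orth (ip := ip) K1.
Proof.
move=> [cK1 cK2 o dec]; apply/seteqP; split=> [y Ky x Kx|y hy].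
  by rewrite (ipC hip) o // conjc0.
have [y1 [y2 [K1y K2y yE]]] := dec y.
suff y10 : y1 = 0 by rewrite yE y10 add0r.
apply: (ip_eq0 hip); have := hy _ K1y; rewrite yE (ipDl hip).
by rewrite (ipC hip y1 y2) (o _ _ K1y K2y) conjc0 addr0.
Qed.

(** Maximality gives $K_1\subseteq\mathcal H_1$. The reducing subspace $\mathcal H_1\cap K_2$ is in
    $\mathcal C_{1,r}$, hence zero because $K_2$ is c.n.u.; the $K_2$-component of any vector of
    $\mathcal H_1$ lies in it. *)
Lemma decomp_unique (K1 K2 : set H) :
  orth_decomp ip K1 K2 -> reduces T Tadj K1 -> reduces T Tadj K2 ->
  inCC1r_on ip r T Tadj K1 -> cnu_on ip r T Tadj Tinv K2 ->
  K1 = H1 /\ K2 = orth (ip := ip) H1.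
Proof.
move=> dK rK1 rK2 CK1 [_ cnu].
suff KE : K1 = H1 by rewrite -KE; split=> //; apply: orth_decomp_orthE.
have [cK1 cK2 o dec] := dK; have sK := H1_maximal rK1 CK1.
apply/seteqP; split=> // x hx.
have cH := H1_closed_subspace; have [HT HTa] := H1_reduces.
have cN : closed_subspace (H1 `&` K2).
  move: cH cK2 => [h0 hD hcl] [k0 kD kcl]; split; last exact: closedI.
    by split.
  by move=> a y z [hy ky] [hz kz]; split; [apply: hD | apply: kD].
have rN : reduces T Tadj (H1 `&` K2).
  by case: rK2 => kT kTa; split=> y [hy ky]; split;
    [apply: HT | apply: kT | apply: HTa | apply: kTa].
have N0 := cnu _ cN (@subIsetr _ _ _) rN
  (H1_sub_inCC1r cN rN (@subIsetl _ _ _)).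
have [x1 [x2 [K1x K2x xE]]] := dec x.
have : (H1 `&` K2) x2.
  split=> //; rewrite (_ : x2 = x - x1); last by rewrite xE addrAC subrr add0r.
  by apply: (closed_subspaceB cH) => //; apply: sK.
by rewrite N0 xE => ->; rewrite addr0.
Qed.

End Decomposition.

Theorem theorem3p4 (R : realType) (H : completeNormedModType R[i])
  (ip : H -> H -> R[i]) (r : R) (T Tadj Tinv Tinvadj : H -> H) :
  inner_product ip ->
  0 < r < 1 ->
  (* T is a bounded invertible operator with adjoint Tadj, inverse Tinv,
     and T^{-*} = Tinvadj *)
  bounded_op T -> is_adjoint ip T Tadj ->
  bounded_op Tinv -> cancel T Tinv -> cancel Tinv T ->
  is_adjoint ip Tinv Tinvadj ->
  (* T in C_{1,r}: ||T|| <= 1 and ||r T^{-1}|| <= 1 *)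
  (forall x, `|T x| <= `|x|) ->
  (forall x, r%:C * `|Tinv x| <= `|x|) ->
  exists H1 H2 : set H,
    [/\ (* existence *)
        orth_decomp ip H1 H2 /\ reduces T Tadj H1 /\ reduces T Tadj H2 /\
        inCC1r_on ip r T Tadj H1 /\ cnu_on ip r T Tadj Tinv H2,
        (* uniqueness *)
        (forall K1 K2 : set H,
           orth_decomp ip K1 K2 -> reduces T Tadj K1 -> reduces T Tadj K2 ->
           inCC1r_on ip r T Tadj K1 -> cnu_on ip r T Tadj Tinv K2 ->
           K1 = H1 /\ K2 = H2),
        (* maximality of H1 *)
        (forall M : set H, closed_subspace M -> reduces T Tadj M ->
           inCC1r_on ip r T Tadj M -> M `<=` H1)
      & (* formula for H1 *)
        H1 = H1_formula r T Tadj Tinvadj].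
Proof.
move=> hip r01 bT aT bTi TK TinvK aTi T_le Tinv_le.
exists (H1_formula r T Tadj Tinvadj), (orth (ip := ip) (H1_formula r T Tadj Tinvadj)).
have cH := H1_closed_subspace hip r01 bT aT TK TinvK aTi T_le Tinv_le.
have rH := H1_reduces hip r01 bT aT TK TinvK aTi T_le Tinv_le.
have HM := H1_maximal hip r01 bT aT TK TinvK aTi T_le Tinv_le.
split=> //.
- split; first exact: orth_decomp_orth.
  split=> //; split; first exact: orth_reduces.
  split; first exact: (H1_sub_inCC1r hip r01 bT aT TK TinvK aTi T_le Tinv_le).
  exact: (orth_H1_cnu hip r01 bT aT TK TinvK aTi T_le Tinv_le).
- exact: (decomp_unique hip r01 bT aT TK TinvK aTi T_le Tinv_le).
- by move=> M _; apply: HM.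
Qed.
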